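(* Let $R$ be an integral domain. The following are equivalent: (1) $R$ is a boundary valuation domain (BVD); (2) $R$ is a half factorial domain (HFD) having a boundary positive, boundary complete, valuation overring $V$ with $G(V)\cong_o \mathbb{Z}$; (3) $G(R)\cong_o \mathbb{Z}\circ \big(U(V)/U(R)\big)$ for some overring $V$ of $R$, where $U(V)/U(R)$ is trivially ordered; (4) $R$ is an atomic pseudo-valuation domain (PVD).
   Context: For an integral domain $R$: $QF(R)$ is its quotient field, $R^\sharp$ the set of its nonzero elements, $U(R)$ its group of units. The group of divisibility is $G(R)=QF(R)^\sharp/U(R)$, partially ordered by $\alpha U(R)\le \beta U(R)$ iff there is $r\in R$ with $\alpha r=\beta$. For partially ordered groups (po-groups), $\cong_o$ means that there is a group isomorphism $\phi$ such that both $\phi$ and $\phi^{-1}$ are order preserving. $\mathbb{Z}$ has its usual order. For abelian po-groups $A,B$, the lexicographic sum $A\circ B$ is the group $A\oplus B$ with order $(a_1,b_1)\le(a_2,b_2)$ iff $a_1<a_2$, or $a_1=a_2$ and $b_1\le b_2$. Trivially ordered means $a\le b$ iff $a=b$. A prime ideal $I$ of $R$ is strongly prime if for all $a,b\in QF(R)$, $ab\in I$ implies $a\in I$ or $b\in I$. $R$ is a pseudo-valuation domain (PVD) if every prime ideal of $R$ is strongly prime. $R$ is atomic if every nonzero nonunit is a finite product of irreducibles. $R$ is a half factorial domain (HFD) if every nonzero (nonunit) element factors into irreducibles and any two factorizations of the same element into irreducibles have the same number of irreducible factors. A boundary valuation domain (BVD) is an HFD $R$ such that every element of $QF(R)$ with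 more irreducibles in the numerator than in the denominator lies in $R$; that is, for every $\frac{a}{b}\in QF(R)$ with irreducible factorization $\frac{\pi_1\cdots\pi_n}{\eta_1\cdots\eta_m}$ (up to units of $R$) and $n>m$, one has $\frac{a}{b}\in R$. An overring of $R$ is a ring $T$ with $R\subseteq T\subset QF(R)$. A valuation overring is an overring $V$ that is a valuation domain: for every nonzero $a\in QF(V)$, $a\in V$ or $a^{-1}\in V$. For an HFD $R$, an overring $T$ is boundary positive if every $x\in T^\sharp$ has at least as many irreducibles of $R$ in the numerator as in the denominator (when written as a quotient of products of irreducibles of $R$, up to units of $R$); $T$ is boundary complete if for every $x\in T^\sharp$ with an equal number of irreducibles of $R$ in the numerator and denominator, we have $x\in R^\sharp$ (equivalently $x\in U(R)$).
   Formalization: R is assumed not to be a field (fields satisfy (1),(4) but not (2),(3)), and ''boundary complete'' asks x ∈ R for x in T with an unequal (not equal) number of irreducibles in numerator and denominator; with ''equal'', (1)⇒(2) fails for ℝ+Xℂ[[X]]. *)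

(* Defs.v *)
From HB Require Import structures.
From mathcomp Require Import all_boot all_order all_algebra.
From mathcomp Require Import generic_quotient ring_quotient.
From mathcomp Require Import boolp.

Set Implicit Arguments.
Unset Strict Implicit.
Unset Printing Implicit Defensive.

Import Order.Theory GRing.Theory Num.Theory.
Local Open Scope ring_scope.
Local Open Scope quotient_scope.

Notation "x %:F" := (@FracField.tofrac _ x) : ring_scope.

(** * Abelian po-groups

    Abelian groups are [zmodType]s, so multiplicative groups (nonzero elements
    of a field, unit groups and their quotients) are written additively.
    Po-groups are [porderZmodType]s. *)

Definition po_isomorphic (A B : porderZmodType) : Prop :=
  exists (phi : {additive A -> B}) (psi : B -> A),
    [/\ cancel phi psi, cancel psi phi,
        {homo phi : x y / x <= y} & {homo psi : x y / x <= y}].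

(* A ∘ B: the direct sum of groups with the library's lexicographic order. *)
Definition lex_sum (A B : porderZmodType) : Type := A *lexi[ring_display] B.

HB.instance Definition _ (A B : porderZmodType) :=
  Order.POrder.on (lex_sum A B).
HB.instance Definition _ (A B : porderZmodType) :=
  GRing.Zmodule.copy (lex_sum A B) (A * B)%type.

Lemma lex_sum_leE (A B : porderZmodType) (x y : lex_sum A B) :
  (x <= y) = (x.1 < y.1) || ((x.1 == y.1) && (x.2 <= y.2)).
Proof. by rewrite leEprodlexi; case: comparableP => //= ->; rewrite lexx. Qed.

Definition trivially_ordered (A : zmodType) : Type := A.
HB.instance Definition _ (A : zmodType) := GRing.Zmodule.on (trivially_ordered A).

Section TriviallyOrdered.
Variable A : zmodType.

Definition triv_le : rel (trivially_ordered A) := fun a b => a == b.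

Fact triv_le_refl : reflexive triv_le.
Proof. by move=> a; exact: eqxx. Qed.

Fact triv_le_anti : antisymmetric triv_le.
Proof. by move=> a b /andP[/eqP]. Qed.

Fact triv_le_trans : transitive triv_le.
Proof. by move=> b a c /eqP->. Qed.

HB.instance Definition _ :=
  Order.Le_isPOrder.Build ring_display (trivially_ordered A)
    triv_le_refl triv_le_anti triv_le_trans.

End TriviallyOrdered.

(** * Unit groups and groups of divisibility of subrings of a field *)

Definition mult_group (K : fieldType) : Type := {x : K | x != 0}.

HB.instance Definition _ (K : fieldType) :=
  SubChoice.copy (mult_group K) {x : K | x != 0}.

Section MultGroup.
Variable K : fieldType.
Implicit Types x y z : mult_group K.

Definition mg_one : mult_group K := exist _ 1 (oner_neq0 K).

Definition mg_mul x y : mult_group K :=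
  exist _ (val x * val y) (mulf_neq0 (valP x) (valP y)).

Fact mg_inv_subproof x : (val x)^-1 != 0.
Proof. by rewrite invr_eq0; exact: valP x. Qed.

Definition mg_inv x : mult_group K := exist _ (val x)^-1 (mg_inv_subproof x).

Fact mg_mulA : associative mg_mul.
Proof. by move=> x y z; apply: val_inj; exact: mulrA. Qed.

Fact mg_mulC : commutative mg_mul.
Proof. by move=> x y; apply: val_inj; exact: mulrC. Qed.

Fact mg_mul1 : left_id mg_one mg_mul.
Proof. by move=> x; apply: val_inj; exact: mul1r. Qed.

Fact mg_mulV : left_inverse mg_one mg_inv mg_mul.
Proof. by move=> x; apply: val_inj; exact: mulVf (valP x). Qed.

HB.instance Definition _ :=
  GRing.isZmodule.Build (mult_group K) mg_mulA mg_mulC mg_mul1 mg_mulV.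

End MultGroup.

Section UnitsOf.
Variables (K : fieldType) (A : subringClosed K).

Definition units_of : {pred mult_group K} :=
  fun x => (val x \in A) && ((val x)^-1 \in A).

Fact units_of_zmod_closed : zmod_closed units_of.
Proof.
split=> [|x y /andP[xA xVA] /andP[yA yVA]]; rewrite unfold_in /=.
  by rewrite invr1 rpred1.
by rewrite invfM invrK !rpredM.
Qed.

HB.instance Definition _ :=
  GRing.isZmodClosed.Build (mult_group K) units_of units_of_zmod_closed.

Definition unit_group : Type := {x : mult_group K | x \in units_of}.

HB.instance Definition _ :=
  SubChoice.copy unit_group {x : mult_group K | x \in units_of}.
HB.instance Definition _ :=
  [SubChoice_isSubZmodule of unit_group by <:].

End UnitsOf.

Section Divisibility.
Variables (K : fieldType) (A : subringClosed K).

(* K^♯ / U(A); this is G(A) when K is the quotient field of A. *)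
Definition div_group : Type := {ideal_quot (units_of A)}.

HB.instance Definition _ := GRing.Zmodule.on div_group.
HB.instance Definition _ := EqQuotient.on div_group.

Definition div_le : rel div_group := fun a b =>
  `[< exists2 r, r \in A & val (repr a) * r = val (repr b) >].

Lemma div_group_eq (x y : mult_group K) :
  (\pi_div_group x == \pi_div_group y) = (x - y \in units_of A).
Proof. by rewrite piE. Qed.

Lemma div_leP (a b : div_group) :
  div_le a b = ((val (repr a))^-1 * val (repr b) \in A).
Proof.
apply/asboolP/idP => [[r rA <-]|abA]; first by rewrite mulKf ?(valP (repr a)).
by eexists; [exact: abA | rewrite mulVKf ?(valP (repr a))].
Qed.

(* The order does not depend on the representatives. *)
Lemma div_leE (x y : mult_group K) :
  div_le (\pi x) (\pi y) = ((val x)^-1 * val y \in A).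
Proof.
have rep z : exists2 u, z = repr (\pi_div_group z) + u & u \in units_of A.
  exists (z - repr (\pi_div_group z)); first by rewrite addrC subrK.
  by rewrite -div_group_eq reprK.
rewrite div_leP; have [u xE /andP[uA uVA]] := rep x.
have [v yE /andP[vA vVA]] := rep y.
set a := repr _ in xE *; set b := repr _ in yE *.
have -> : val x = val a * val u by rewrite xE.
have -> : val y = val b * val v by rewrite yE.
have u0 := valP u; have v0 := valP v; rewrite /= in u0 v0.
apply/idP/idP => abA.
  have -> : (val a * val u)^-1 * (val b * val v)
          = (val u)^-1 * ((val a)^-1 * val b) * val v.
    by rewrite invfM [X in X * _]mulrC !mulrA.
  exact: rpredM (rpredM uVA abA) vA.
have -> : (val a)^-1 * val b
    = val u * ((val a * val u)^-1 * (val b * val v)) * (val v)^-1.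
  by rewrite invfM !mulrA mulfK // [val u * _]mulrC mulfK.
exact: rpredM (rpredM uA abA) vVA.
Qed.

Fact div_le_refl : reflexive div_le.
Proof. by move=> a; rewrite div_leP mulVf ?rpred1 // (valP (repr a)). Qed.

Fact div_le_anti : antisymmetric div_le.
Proof.
move=> a b; rewrite !div_leP => /andP[abA baA].
apply/eqP; rewrite -[a]reprK -[b]reprK div_group_eq unfold_in /=.
by rewrite invfM invrK -[val (repr a) / _]mulrC baA abA.
Qed.

Fact div_le_trans : transitive div_le.
Proof.
move=> b a c; rewrite !div_leP => abA bcA.
by have := rpredM abA bcA; rewrite mulrA mulfK ?(valP (repr b)).
Qed.

HB.instance Definition _ :=
  Order.Le_isPOrder.Build ring_display div_group
    div_le_refl div_le_anti div_le_trans.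

End Divisibility.

Section UnitsQuotient.
Variables (K : fieldType) (B A : subringClosed K).

(* The subgroup U(A) of U(B), for A contained in B. *)
Definition subunits : {pred unit_group B} := fun x => val x \in units_of A.

Fact subunits_zmod_closed : zmod_closed subunits.
Proof.
split=> [|x y xA yA]; first exact: (rpred0 (units_of A)).
exact: (rpredB (S := units_of A) xA yA).
Qed.

HB.instance Definition _ :=
  GRing.isZmodClosed.Build (unit_group B) subunits subunits_zmod_closed.

(* U(B) / U(A) *)
Definition units_quotient : Type := {ideal_quot subunits}.

HB.instance Definition _ := GRing.Zmodule.on units_quotient.

End UnitsQuotient.

(** * Integral domains and their overrings

    The quotient field of [R] is [{fraction R}]; [R] is identified with its
    image [base_ring R] there. *)

Section Domains.
Variable R : idomainType.
Implicit Types (p x y : R) (s t : seq R) (a b : {fraction R}).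
Implicit Types (T : subringClosed {fraction R}).

Definition base_ring : {pred {fraction R}} := fun a => `[< exists x, a = x%:F >].

Fact base_ring_closed : subring_closed base_ring.
Proof.
split=> [|_ _ /asboolP[x ->] /asboolP[y ->]|_ _ /asboolP[x ->] /asboolP[y ->]].
- by apply/asboolP; exists 1; rewrite rmorph1.
- by apply/asboolP; exists (x - y); rewrite rmorphB.
- by apply/asboolP; exists (x * y); rewrite rmorphM.
Qed.

HB.instance Definition _ :=
  GRing.isSubringClosed.Build {fraction R} base_ring base_ring_closed.

Definition irreducible p : Prop :=
  [/\ p != 0, p \isn't a GRing.unit &
      forall x y, p = x * y -> x \is a GRing.unit \/ y \is a GRing.unit].

Definition irreducibles s : Prop := forall p, p \in s -> irreducible p.

Definition atomic : Prop :=
  forall x, x != 0 -> x \isn't a GRing.unit ->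
    exists2 s, irreducibles s & x = \prod_(p <- s) p.

Definition HFD : Prop :=
  atomic /\
  forall s t, irreducibles s -> irreducibles t ->
    \prod_(p <- s) p = \prod_(p <- t) p -> size s = size t.

(* [a] is, up to a unit of R, the quotient of the product of the irreducibles
   [s] by the product of the irreducibles [t]. *)
Definition fraction_factorization s t a : Prop :=
  [/\ irreducibles s, irreducibles t &
      exists2 u : R, u \is a GRing.unit &
        a = (u * \prod_(p <- s) p)%:F / (\prod_(p <- t) p)%:F].

Definition BVD : Prop :=
  HFD /\
  forall a s t, fraction_factorization s t a -> (size t < size s)%N ->
    a \in base_ring.

Definition overring T : Prop :=
  {subset base_ring <= T} /\ exists a, a \notin T.

(* An overring has the same quotient field as R. *)
Definition valuation_overring T : Prop :=
  overring T /\ forall a, a != 0 -> a \in T \/ a^-1 \in T.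

Definition boundary_positive T : Prop :=
  forall a s t, a \in T -> a != 0 -> fraction_factorization s t a ->
    (size t <= size s)%N.

(* A nonzero element of T with unequal numbers of irreducibles in the numerator
   and in the denominator lies in R.  With "equal" in place of "unequal", the
   valuation overring C[[X]] of the boundary valuation domain R + X C[[X]] over
   the reals would be excluded, since it contains i = (i X) / X. *)
Definition boundary_complete T : Prop :=
  forall a s t, a \in T -> a != 0 -> fraction_factorization s t a ->
    size s <> size t -> a \in base_ring.

Definition strongly_prime (I : {pred R}) : Prop :=
  forall a b, (exists2 x, x \in I & a * b = x%:F) ->
    (exists2 x, x \in I & a = x%:F) \/ (exists2 x, x \in I & b = x%:F).

Definition PVD : Prop := forall I : prime_idealr R, strongly_prime I.

Definition not_a_field : Prop := exists2 x : R, x != 0 & x \isn't a GRing.unit.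

End Domains.

Arguments base_ring R : clear implicits.
Arguments atomic R : clear implicits.
Arguments HFD R : clear implicits.
Arguments BVD R : clear implicits.
Arguments PVD R : clear implicits.
Arguments not_a_field R : clear implicits.

(* Main.v *)
(** All four conditions say that there is a group morphism [v] from the nonzero
    fractions onto the integers such that the nonzero elements of R are its
    units, where [v] vanishes, and the fractions where [v] is positive.  In a
    BVD, [v] counts irreducibles in the numerator minus the denominator; in (3)
    it is the first component of the isomorphism.  Conversely, given [v], the
    irreducibles of R are its elements of value 1, [{v >= 0}] is the overring
    V, and dividing by powers of an element of value 1 splits G(R).

    In a PVD the nonunits form the maximal ideal M, and M is strongly prime.  If
    the quotient c of two irreducibles did not satisfy c M <= M, then strong
    primality would put c^-1 in M, making one irreducible a proper multiple of
    the other.  Hence a quotient of products of irreducibles with more factors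
    in the numerator lies in M, which gives both HFD and BVD. *)

Require Import Defs.
From HB Require Import structures.
From mathcomp Require Import all_boot all_order all_algebra.
From mathcomp Require Import generic_quotient ring_quotient.
From mathcomp Require Import boolp classical_sets.
From mathcomp Require Import zify ring.

Set Implicit Arguments.
Unset Strict Implicit.
Unset Printing Implicit Defensive.

Import Order.Theory GRing.Theory Num.Theory.
Local Open Scope ring_scope.
Local Open Scope quotient_scope.

(** * Factorizations of elements and of fractions into irreducibles, up to units *)

Section Factorizations.
Variable R : idomainType.
Implicit Types (p x y u : R) (s t : seq R) (a b : {fraction R}).

Lemma fraction_numden a : exists x y, y != 0 /\ a = x%:F / y%:F.
Proof.
elim/quotW: a => r; exists r.1, r.2; split; first exact: denom_ratioP.
apply: (canRL (mulfK _)); first by rewrite tofrac_eq0 denom_ratioP.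
(* What is left is an equality of two classes of ratios, that is, a cross-multiplication in R. *)
rewrite -[LHS]/(FracField.mul _ _) !piE; apply/eqmodP.
rewrite /= FracField.equivfE /FracField.mulf.
by rewrite !numden_Ratio ?mulf_neq0 ?oner_eq0 ?denom_ratioP // !mulr1 mulrC.
Qed.

Lemma base_ringP a : reflect (exists x, a = x%:F) (a \in base_ring R).
Proof. exact: asboolP. Qed.

Lemma irreducible_unitMl u p :
  u \is a GRing.unit -> irreducible p -> irreducible (u * p).
Proof.
move=> uU [p0 pNU pirr]; split.
- by rewrite mulf_neq0 //; apply: contraTneq uU => ->; rewrite unitr0.
- by rewrite unitrM uU.
move=> x y upE; have := pirr (u^-1 * x) y; rewrite unitrM unitrV uU /=.
by apply; rewrite -mulrA -upE mulKr.
Qed.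

Lemma irreducibles_cat s t :
  irreducibles s -> irreducibles t -> irreducibles (s ++ t).
Proof. by move=> sI tI p; rewrite mem_cat => /orP[/sI|/tI]. Qed.

Lemma irreducibles_cons p s :
  irreducibles (p :: s) <-> irreducible p /\ irreducibles s.
Proof.
split=> [psI|[pI sI] q]; last by rewrite inE => /predU1P[->|/sI].
by split=> [|q qs]; apply: psI; rewrite inE ?eqxx ?qs ?orbT.
Qed.

Lemma prod_irreducibles_neq0 s : irreducibles s -> \prod_(p <- s) p != 0.
Proof.
by move=> sI; rewrite prodf_seq_neq0; apply/allP => p /sI[p0 _ _]; exact: p0.
Qed.

Lemma unit_prod_irreducibles s :
  irreducibles s -> \prod_(p <- s) p \is a GRing.unit -> s = [::].
Proof.
case: s => // p s /irreducibles_cons[[_ pNU _] _].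
by rewrite big_cons unitrM (negPf pNU).
Qed.

Lemma atomic_factor x : atomic R -> x != 0 ->
  exists s u,
    [/\ irreducibles s, u \is a GRing.unit & x = u * \prod_(p <- s) p].
Proof.
move=> Rat x0; have [xU|xNU] := boolP (x \is a GRing.unit).
  by exists [::], x; split; rewrite ?big_nil ?mulr1.
have [s sI xE] := Rat x x0 xNU.
by exists s, 1; rewrite unitr1 mul1r.
Qed.

Lemma atomic_fraction_factorization a : atomic R -> a != 0 ->
  exists s t, fraction_factorization s t a.
Proof.
move=> Rat; have [x [y [y0 ->]]] := fraction_numden a.
rewrite mulf_eq0 invr_eq0 !tofrac_eq0 (negPf y0) orbF => x0.
have [s [u [sI uU xE]]] := atomic_factor Rat x0.
have [t [w [tI wU yE]]] := atomic_factor Rat y0.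
exists s, t; split=> //; exists (u / w); first by rewrite unitrM unitrV uU.
have w0 : w%:F != 0.
  by rewrite tofrac_eq0; apply: contraTneq wU => ->; rewrite unitr0.
have t0 := prod_irreducibles_neq0 tI; rewrite -tofrac_eq0 in t0.
have -> : u / w * \prod_(p <- s) p = x / w by rewrite xE mulrAC.
have -> : x%:F = (x / w)%:F * w%:F by rewrite -tofracM divrK.
by rewrite yE [(w * _)%:F]tofracM [w%:F * _]mulrC -mulf_div divff // mulr1.
Qed.

Lemma fraction_factorizationM s t s' t' a b :
  fraction_factorization s t a -> fraction_factorization s' t' b ->
  fraction_factorization (s ++ s') (t ++ t') (a * b).
Proof.
move=> [sI tI [u uU ->]] [s'I t'I [w wU ->]].
split; [exact: irreducibles_cat | exact: irreducibles_cat |].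
exists (u * w); first by rewrite unitrM uU.
by rewrite !big_cat /= mulf_div -!tofracM mulrACA.
Qed.

Lemma fraction_factorization_int x s u : irreducibles s -> u \is a GRing.unit ->
  x = u * \prod_(p <- s) p -> fraction_factorization s [::] x%:F.
Proof.
by move=> sI uU ->; split=> //; exists u; rewrite // big_nil tofrac1 divr1.
Qed.

(** The unit is absorbed into the first irreducible of [s]. If [s] is empty, the product of [t] is a
    unit, so [t] is empty too. *)
Lemma HFD_size s t u : HFD R -> irreducibles s -> irreducibles t ->
  u \is a GRing.unit -> u * \prod_(p <- s) p = \prod_(p <- t) p ->
  size s = size t.
Proof.
move=> [_ Rhf] sI tI uU; case: s sI => [_|p s /irreducibles_cons[pI sI]].
  rewrite big_nil mulr1 => uE; rewrite (unit_prod_irreducibles tI) //.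
  by rewrite -uE.
rewrite big_cons mulrA => psE; apply: (Rhf (u * p :: s)) => //.
  by apply/irreducibles_cons; split=> //; exact: irreducible_unitMl.
by rewrite big_cons.
Qed.

(** Cross-multiplication gives two factorizations of one element of R, up to a unit. Thus
    [size s - size t], as an integer, depends on the fraction alone, which makes the count of
    irreducibles well defined. *)
Lemma HFD_fraction_size s t s' t' a : HFD R ->
  fraction_factorization s t a -> fraction_factorization s' t' a ->
  (size s + size t')%N = (size s' + size t)%N.
Proof.
move=> Rhfd [sI tI [u uU aE]] [s'I t'I [w wU]].
have t0 := prod_irreducibles_neq0 tI; rewrite -tofrac_eq0 in t0.
have t'0 := prod_irreducibles_neq0 t'I; rewrite -tofrac_eq0 in t'0.
rewrite aE => /eqP; rewrite eqr_div // -!tofracM tofrac_eq => /eqP stE.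
rewrite -!size_cat; apply: (@HFD_size _ _ (w^-1 * u)) => //.
- exact: irreducibles_cat.
- exact: irreducibles_cat.
- by rewrite unitrM unitrV wU.
rewrite !big_cat /= mulrA -(mulrA _ u) -mulrA stE.
by rewrite -[w * _ * _]mulrA mulKr.
Qed.

End Factorizations.

(** * From an atomic PVD to a BVD, through strong primality of the nonunits *)

Section PseudoValuation.
Variable R : idomainType.
Implicit Types (p q x y m : R) (s t : seq R) (a b c : {fraction R}).

Definition nonunits : {pred R} := [pred x : R | x \isn't a GRing.unit].

(** The empty set qualifies, so that the union of the empty chain is covered when Zorn's lemma is
    applied. *)
Definition proper_ideal_set (I : set R) : Prop :=
  [/\ forall x y, I x -> I y -> I (x + y), forall x y, I y -> I (x * y) &
      ~ I 1].

Lemma maximal_proper_ideal_set : exists2 I : set R, proper_ideal_set I &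
  forall J : set R, (I `<=` J)%classic -> proper_ideal_set J ->
    (J `<=` I)%classic.
Proof.
have [|I [Iid Imax]] := @Zorn_bigcup R proper_ideal_set.
  move=> F FI Ftot; split=> [x y|x y|]; last by case=> J /FI[_ _ J1] /J1.
    move=> [J FJ Jx] [K FK Ky]; have [JK|KJ] := Ftot J K FJ FK.
      by exists K => //; have [KD _ _] := FI K FK; apply: KD => //; exact: JK.
    by exists J => //; have [JD _ _] := FI J FJ; apply: JD => //; exact: KJ.
  by move=> [J FJ Jy]; exists J => //; have [_ JM _] := FI J FJ; exact: JM.
exists I => // J IJ Jid; apply: contrapT => nJI.
by apply: (Imax J) => //; split.
Qed.

Lemma maximal_prime_idealr : exists I : prime_idealr R,
  forall J : set R, (forall x, x \in I -> J x) -> proper_ideal_set J ->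
  forall x, J x -> x \in I.
Proof.
have [M Mid Mmax] := maximal_proper_ideal_set; have [MD MM M1] := Mid.
have M0 : M 0.
  (* Adjoining 0 to [M] keeps it closed and proper, so maximality already puts 0 in [M]. *)
  have : proper_ideal_set (fun x => M x \/ x = 0).
    split=> [x y [Mx|->] [My|->]|x y [My|->]|[//|/eqP]].
    - by left; exact: MD.
    - by left; rewrite addr0.
    - by left; rewrite add0r.
    - by right; rewrite addr0.
    - by left; exact: MM.
    - by right; rewrite mulr0.
    - by rewrite oner_eq0.
  by move=> /(Mmax _ (fun x Mx => or_introl Mx)); apply; right.
pose I : {pred R} := fun x => `[< M x >].
have IE x : (x \in I) <-> M x by split=> /asboolP.
have Iid : idealr_closed I.
  split=> [||a x y /IE Mx /IE My]; [exact/IE | by apply/negP => /IE |].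
  by apply/IE/MD => //; exact: MM.
have Ipr : prime_idealr_closed I.
  move=> x y /IE Mxy; have [/IE->//|nMx] := pselect (M x).
  apply/orP; right; apply/IE.
  (* [J] is [M + R x]. If it contains [1 = m + r x], then [y = m y + r (x y)] lies in [M]; otherwise
     it is proper, and maximality puts [x] in [M]. *)
  pose J z := exists2 m, M m & exists r, z = m + r * x.
  have MJ : (M `<=` J)%classic.
    by move=> m Mm; exists m => //; exists 0; rewrite mul0r addr0.
  have Jx : J x by exists 0 => //; exists 1; rewrite mul1r add0r.
  have [[m Mm [r mrE]]|J1] := pselect (J 1).
    rewrite -[y]mul1r mrE mulrDl -mulrA.
    by apply: MD; [rewrite mulrC|]; exact: MM.
  case: nMx; apply: (Mmax J) => //; split=> //.
    move=> _ _ [m Mm [r ->]] [m' Mm' [r' ->]]; exists (m + m'); first exact: MD.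
    by exists (r + r'); ring.
  move=> z _ [m Mm [r ->]]; exists (z * m); first exact: MM.
  by exists (z * r); ring.
pose P : prime_idealr R := HB.pack (I : R -> bool)
  (isIdealr.Build R I Iid) (isPrimeIdealrClosed.Build R I Ipr).
by exists P => J PJ Jid x Jx; apply/IE/(Mmax J) => // m /IE; exact: PJ.
Qed.

(* A maximal ideal [I] is strongly prime; if a nonunit [y] were outside [I],
   then [(z / y) y = z] would give [I <= (y)] for all [z] in [I], against
   maximality. *)
Lemma PVD_nonunits : PVD R -> strongly_prime nonunits.
Proof.
move=> Rpvd; have [I Imax] := maximal_prime_idealr.
suff IE : nonunits =i I.
  move=> a b [x]; rewrite IE => xI abE.
  by have [[y yI ->]|[y yI ->]] := Rpvd I a b (ex_intro2 _ _ x xI abE);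
    [left|right]; exists y; rewrite // IE.
move=> y; apply/idP/idP => [|yI]; rewrite inE; last first.
  apply/negP => yU; have := idealr1 I.
  by rewrite -[1](mulVr yU) prime_idealrM yI orbT.
move=> yNU.
apply: contraT => yNI; suff: y \in I by rewrite (negPf yNI).
have [y0|y0] := eqVneq y 0; first by rewrite y0 rpred0.
apply: (Imax (fun z => exists r, z = r * y)); last by exists 1; rewrite mul1r.
  move=> z zI; have [|[r _ zyE]|[r rI]] := Rpvd I (z%:F / y%:F) y%:F.
  - by exists z; rewrite // divfK // tofrac_eq0.
  - exists r; apply/eqP; rewrite -tofrac_eq tofracM -zyE divfK //.
    by rewrite tofrac_eq0.
  - by move=> /eqP; rewrite tofrac_eq => /eqP yE; rewrite yE rI in yNI.
split=> [_ _ [r ->] [r' ->]|x _ [r ->]|[r rE]].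
- by exists (r + r'); rewrite mulrDl.
- by exists (x * r); rewrite mulrA.
by case/negP: yNU; apply/unitrP; exists r; split; rewrite // mulrC.
Qed.

(** With M the set of nonunits, this is membership of [c] in the colon set [(M : M)]. *)
Definition stabilizes_nonunits c : Prop :=
  forall m, m \in nonunits -> exists2 n, n \in nonunits & c * m%:F = n%:F.

Hypothesis nonunits_sprime : strongly_prime nonunits.

Lemma sprime_mul a b m : m \in nonunits -> a * b = m%:F ->
  (exists2 n, n \in nonunits & a = n%:F) \/
  (exists2 n, n \in nonunits & b = n%:F).
Proof. by move=> mN abE; apply: nonunits_sprime; exists m. Qed.

(** Take a nonunit [m] with [c^-1 m] not a nonunit of R. The product [c (c^-1 m) = m] is a nonunit,
    so strong primality leaves only [c]. *)
Lemma stabilizes_nonunits_inv c : c != 0 -> ~ stabilizes_nonunits c^-1 ->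
  exists2 n, n \in nonunits & c = n%:F.
Proof.
move=> c0 /existsNP[m /not_implyP[mN cmN]].
have : c * (c^-1 * m%:F) = m%:F by rewrite mulVKf.
by move=> /(sprime_mul mN)[//|[k kN cmE]]; case: cmN; exists k.
Qed.

Lemma stabilizes_irreducible_div p q : irreducible p -> irreducible q ->
  stabilizes_nonunits (p%:F / q%:F).
Proof.
move=> [p0 pNU _] [q0 _ qirr]; apply: contrapT => npq.
have [||n nN] := @stabilizes_nonunits_inv (q%:F / p%:F).
- by rewrite mulf_neq0 ?invr_eq0 ?tofrac_eq0.
- by rewrite invf_div.
move=> /(canRL (divfK _)); rewrite tofrac_eq0 -tofracM => /(_ p0) /eqP.
rewrite tofrac_eq => /eqP /qirr[nU|pU]; first by rewrite inE nU in nN.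
by rewrite pU in pNU.
Qed.

Lemma stabilizes_prod_div s t : irreducibles s -> irreducibles t ->
  size s = size t ->
  stabilizes_nonunits ((\prod_(p <- s) p)%:F / (\prod_(p <- t) p)%:F).
Proof.
elim: s t => [|p s IHs] [|q t] //=.
  by move=> _ _ _ m mN; exists m; rewrite // !big_nil tofrac1 divr1 mul1r.
move=> /irreducibles_cons[pI sI] /irreducibles_cons[qI tI] [stE] m mN.
have [n nN mnE] := IHs t sI tI stE m mN.
have [k kN nkE] := stabilizes_irreducible_div pI qI nN.
exists k => //; rewrite !big_cons !tofracM -mulf_div.
by rewrite -nkE -mnE [RHS]mulrA.
Qed.

(** The first [size t] factors of [s], divided by the product of [t], stabilize the nonunits. The
    remaining factors form a nonempty product of irreducibles, which is a nonunit. *)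
Lemma nonunits_prod_div s t : irreducibles s -> irreducibles t ->
  (size t < size s)%N ->
  exists2 n, n \in nonunits &
    (\prod_(p <- s) p)%:F / (\prod_(p <- t) p)%:F = n%:F.
Proof.
move=> sI tI ts; have take_irr k : irreducibles (take k s).
  by move=> p /mem_take /sI.
have drop_irr k : irreducibles (drop k s) by move=> p /mem_drop /sI.
rewrite -(cat_take_drop (size t) s) big_cat /= tofracM mulrAC.
apply: stabilizes_prod_div; rewrite ?size_takel 1?ltnW // inE.
apply/negP => /(unit_prod_irreducibles (drop_irr _)) /(congr1 size).
by rewrite size_drop /= => /eqP; rewrite subn_eq0 leqNgt ts.
Qed.

(** If [s] were longer, the quotient of the two equal products, which is 1, would be a nonunit. *)
Lemma sprime_nonunits_size_le s t : irreducibles s -> irreducibles t ->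
  \prod_(p <- s) p = \prod_(p <- t) p -> (size s <= size t)%N.
Proof.
move=> sI tI stE; rewrite leqNgt; apply/negP => ts.
have [n nN] := nonunits_prod_div sI tI ts.
rewrite stE divff ?tofrac_eq0 ?prod_irreducibles_neq0 // -tofrac1 => /eqP.
by rewrite tofrac_eq => /eqP nE; rewrite inE -nE unitr1 in nN.
Qed.

Lemma atomic_sprime_BVD : atomic R -> BVD R.
Proof.
move=> Rat; split; first split=> // s t sI tI stE.
  by apply/eqP; rewrite eqn_leq !sprime_nonunits_size_le.
move=> a s t [sI tI [u uU ->]] ts.
have [n _ nE] := nonunits_prod_div sI tI ts.
by rewrite tofracM -mulrA nE -tofracM; apply/base_ringP; exists (u * n).
Qed.

End PseudoValuation.

(** By antisymmetry in [B], the order hypothesis says that [f] identifies exactly the elements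
    dividing each other in [A]. So [f] descends to an injective map on classes, and its section [g]
    gives surjectivity. *)
Lemma div_group_po_isomorphic (K : fieldType) (A : subringClosed K)
    (B : porderZmodType) (f : mult_group K -> B) (g : B -> mult_group K) :
  zmod_morphism f -> cancel g f ->
  (forall x y, (f x <= f y) = ((val x)^-1 * val y \in A)) ->
  po_isomorphic (div_group A) B.
Proof.
move=> fB gK f_le; pose phi (c : div_group A) := f (repr c).
have f_pi_le x y : (f x <= f y) = (\pi_(div_group A) x <= \pi_(div_group A) y).
  by rewrite f_le; symmetry; exact: div_leE.
have phi_pi x : phi (\pi x) = f x.
  by apply: le_anti; rewrite !f_pi_le reprK lexx.
have phiB : zmod_morphism phi.
  move=> c d; rewrite -[c]reprK -[d]reprK.
  have -> : \pi_(div_group A) (repr c) - \pi_(div_group A) (repr d)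
      = \pi_(div_group A) (repr c - repr d) by rewrite !piE.
  by rewrite !phi_pi fB.
pose phia : {additive div_group A -> B} :=
  HB.pack phi (GRing.isZmodMorphism.Build _ _ phi phiB).
exists phia, (fun b => \pi_(div_group A) (g b)); split.
- move=> c; rewrite -[RHS]reprK /=; apply: le_anti.
  by rewrite -!f_pi_le !gK lexx.
- by move=> b; rewrite [LHS]phi_pi gK.
- by move=> c d; rewrite -[c in c <= _]reprK -[d in _ <= d]reprK -f_pi_le.
- by move=> b c; rewrite -{1}[b]gK -{1}[c]gK f_pi_le.
Qed.

(** * Constructing the boundary valuation from a BVD or from a lexicographic sum *)

Section BoundaryValuation.
Variable R : idomainType.
Implicit Types (v : {fraction R} -> int) (a b c : {fraction R}) (s t : seq R).

(** Values are plain integers and [v 0] is arbitrary, so every clause speaks of nonzero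
    fractions. *)
Record boundary_valuation v : Prop := BoundaryValuation {
  bvM : forall a b, a != 0 -> b != 0 -> v (a * b) = v a + v b;
  bv_gt0 : forall a, a != 0 -> 0 < v a -> a \in base_ring R;
  bv_ge0 : forall a, a != 0 -> a \in base_ring R -> 0 <= v a;
  bv_eq0 : forall a, a != 0 -> a \in base_ring R -> v a = 0 ->
    a^-1 \in base_ring R;
  bv_prime : exists2 p, p != 0 & v p = 1
}.

Lemma BVD_boundary_valuation : not_a_field R -> BVD R ->
  exists v, boundary_valuation v.
Proof.
move=> [z z0 zNU] [Rhfd Rbv]; have Rat := Rhfd.1.
(* Choice picks the count of some factorization of each nonzero fraction; at 0 the requirement is
   vacuous. *)
have [a|v vP] := @choice _ int (fun a n => a != 0 -> exists s t,
    fraction_factorization s t a /\ n = (size s)%:Z - (size t)%:Z).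
  have [->|a0] := eqVneq a 0; first by exists 0.
  have [s [t stP]] := atomic_fraction_factorization Rat a0.
  by exists ((size s)%:Z - (size t)%:Z) => _; exists s, t.
have vE a s t : a != 0 -> fraction_factorization s t a ->
    v a = (size s)%:Z - (size t)%:Z.
  move=> a0 stP; have [s' [t' [stP' ->]]] := vP a a0.
  by have := HFD_fraction_size Rhfd stP stP'; lia.
have vM a b : a != 0 -> b != 0 -> v (a * b) = v a + v b.
  move=> a0 b0; have [s [t [stP ->]]] := vP a a0.
  have [s' [t' [stP' ->]]] := vP b b0.
  rewrite (vE _ _ _ (mulf_neq0 a0 b0) (fraction_factorizationM stP stP')).
  by rewrite !size_cat; lia.
have v_int a : a != 0 -> a \in base_ring R -> exists s u,
    [/\ irreducibles s, u \is a GRing.unit,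
        a = (u * \prod_(p <- s) p)%:F & v a = (size s)%:Z].
  move=> a0 /base_ringP[x xE]; rewrite xE tofrac_eq0 in a0.
  have [s [u [sI uU xE']]] := atomic_factor Rat a0.
  exists s, u; split; rewrite -?xE' //.
  rewrite (vE a s [::]) ?subr0 // xE ?tofrac_eq0 //.
  exact: fraction_factorization_int xE'.
exists v; split=> //.
- move=> a a0; have [s [t [stP ->]]] := vP a a0.
  by rewrite subr_gt0 => /(Rbv a s t stP).
- by move=> a a0 /(v_int a a0)[s [u [_ _ _ ->]]].
- move=> a a0 /(v_int a a0)[s [u [_ uU -> ->]]] [/size0nil ->].
  by apply/base_ringP; rewrite big_nil mulr1; exists u^-1; rewrite rmorphV.
(* Since R is not a field, some nonunit has a nonempty factorization; its first irreducible has
   value 1. *)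
have [[|p s] /= sI zE] := Rat z z0 zNU.
  by rewrite zE big_nil unitr1 in zNU.
have /irreducibles_cons[pI _] := sI; have [p0 _ _] := pI.
exists p%:F; first by rewrite tofrac_eq0.
rewrite (vE _ [:: p] [::]) ?tofrac_eq0 //.
apply: (@fraction_factorization_int _ p [:: p] 1); rewrite ?unitr1 //.
  by apply/irreducibles_cons.
by rewrite big_seq1 mul1r.
Qed.

Lemma lex_sum_boundary_valuation (H : zmodType) :
  po_isomorphic (div_group (base_ring R)) (lex_sum int (trivially_ordered H)) ->
  exists v, boundary_valuation v.
Proof.
move=> [phi [psi [phiK psiK phi_homo psi_homo]]].
(* Sending 0 to the default 1 makes [w] total on fractions. *)
pose mg a : mult_group {fraction R} := insubd (mg_one {fraction R}) a.
have mgK a : a != 0 -> val (mg a) = a by move=> a0; rewrite insubdK.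
pose D := div_group (base_ring R).
pose w a := phi (\pi_D (mg a)).
have wM a b : a != 0 -> b != 0 -> w (a * b) = w a + w b.
  move=> a0 b0; rewrite /w -raddfD; congr (phi _).
  have -> : mg (a * b) = mg a + mg b.
    by apply: val_inj; rewrite /= !mgK ?mulf_neq0.
  by rewrite !piE.
have phi0 : phi 0 = 0 by exact: raddf0.
have psi0 : psi 0 = 0 by rewrite -phi0 phiK.
have w_ge0 a : a != 0 -> (0 <= w a) = (a \in base_ring R).
  move=> a0; have -> : (0 <= w a) = (0 <= \pi_D (mg a)).
    apply/idP/idP => [/psi_homo|/phi_homo]; first by rewrite psi0 phiK.
    by rewrite phi0.
  have -> : (0 : D) = \pi_D 0 by rewrite !piE.
  by rewrite [LHS]div_leE /= invr1 mul1r mgK.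
exists (fun a => (w a).1); split.
- by move=> a b a0 b0; rewrite wM.
- by move=> a a0 va; rewrite -w_ge0 // lex_sum_leE va.
- by move=> a a0; rewrite -w_ge0 // lex_sum_leE => /orP[/ltW|/andP[/eqP<-]].
(* With first component 0, [0 <= w a] compares second components in a trivial order. Hence
   [w a = 0], and so [w a^-1 = 0]. *)
- move=> a a0; rewrite -w_ge0 // lex_sum_leE => + wa0.
  rewrite wa0 ltxx eqxx /= => /eqP w2; rewrite -w_ge0 ?invr_eq0 //.
  have wa : w a = 0 by case: (w a) wa0 w2 => ? ? /= -> <-.
  have := wM a a^-1 a0; rewrite invr_eq0 => /(_ a0).
  have := wM 1 1 (oner_neq0 _) (oner_neq0 _).
  rewrite divff // mulr1 -{1}[w 1]addr0 => /addrI <-.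
  by rewrite wa add0r => <-.
pose e : lex_sum int (trivially_ordered H) := (1, 0).
exists (val (repr (psi e))); first exact: (valP (repr (psi e))).
have mgval x : mg (val x) = x by apply: val_inj; rewrite mgK ?(valP x).
by rewrite /w mgval reprK psiK.
Qed.

End BoundaryValuation.

(** * Consequences of a boundary valuation: irreducibles, atomicity, the PVD property *)

Section BoundaryValuationTheory.
Variables (R : idomainType) (v : {fraction R} -> int).
Hypothesis Hv : boundary_valuation v.
Implicit Types (a b c : {fraction R}) (x y p q : R) (s t : seq R).

Lemma bv1 : v 1 = 0.
Proof.
have := bvM Hv (oner_neq0 _) (oner_neq0 _).
by rewrite mulr1 -{1}[v 1]addr0 => /addrI <-.
Qed.

Lemma bvV a : a != 0 -> v a^-1 = - v a.
Proof.
move=> a0; have aV0 : a^-1 != 0 by rewrite invr_eq0.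
have := bvM Hv a0 aV0; rewrite divff // bv1.
by move=> /esym/eqP; rewrite addrC addr_eq0 => /eqP.
Qed.

Lemma bv_div a b : a != 0 -> b != 0 -> v (a / b) = v a - v b.
Proof. by move=> a0 b0; rewrite (bvM Hv) ?invr_eq0 // bvV. Qed.

Lemma bvN a : a != 0 -> v (- a) = v a.
Proof.
move=> a0; rewrite -mulN1r (bvM Hv) ?oppr_eq0 ?oner_eq0 //.
have N0 : -1 != 0 :> {fraction R} by rewrite oppr_eq0 oner_eq0.
(* Twice [v (-1)] is [v 1 = 0]. *)
by have := bvM Hv N0 N0; rewrite mulrNN mulr1 bv1; lia.
Qed.

Lemma bvX a (n : int) : a != 0 -> v (a ^ n) = v a * n.
Proof.
move=> a0; have vX (m : nat) : v (a ^+ m) = v a * m%:Z.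
  elim: m => [|m IHm]; first by rewrite expr0 bv1 mulr0.
  by rewrite exprS (bvM Hv) ?expf_neq0 // IHm; lia.
by case: n => n; rewrite ?NegzE -?exprnN -?exprnP ?bvV ?expf_neq0 // vX ?mulrN.
Qed.

Lemma bv_unit x : x \is a GRing.unit -> v x%:F = 0.
Proof.
move=> xU; have x0 : x%:F != 0.
  by rewrite tofrac_eq0; apply: contraTneq xU => ->; rewrite unitr0.
have := bv_ge0 Hv x0; have := @bv_ge0 _ _ Hv x%:F^-1; rewrite invr_eq0 bvV //.
have -> : x%:F^-1 \in base_ring R.
  by apply/base_ringP; exists x^-1; rewrite rmorphV.
have -> : x%:F \in base_ring R by apply/base_ringP; exists x.
by move=> /(_ x0 isT) + /(_ isT); lia.
Qed.

Lemma bv_nonunit x : x != 0 -> x \isn't a GRing.unit -> 0 < v x%:F.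
Proof.
rewrite -tofrac_eq0 => x0 xNU.
have xR : x%:F \in base_ring R by apply/base_ringP; exists x.
rewrite lt_def (bv_ge0 Hv) // andbT; apply: contraNneq xNU.
move=> /(bv_eq0 Hv x0 xR)/base_ringP[y xVy]; apply/unitrP; exists y.
have xyE : x * y = 1.
  by apply/eqP; rewrite -tofrac_eq tofracM -xVy divff ?tofrac1.
by rewrite mulrC xyE.
Qed.

Lemma bv_gt0_nonunit x : 0 < v x%:F -> x \isn't a GRing.unit.
Proof. by apply: contraTN => /bv_unit ->. Qed.

(** Nonunits have positive value, so 1 is not the sum of the values of two of them. Conversely, if
    [v q > 1] and [p] has value 1, then [p] and [q / p] both have positive value, hence are nonunits
    of R, and they factor [q]. *)
Lemma irreducible_bv q : irreducible q <-> q != 0 /\ v q%:F = 1.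
Proof.
split=> [[q0 qNU qirr]|[q0 vq]]; last first.
  split=> // [|x y qE]; first by apply: bv_gt0_nonunit; rewrite vq.
  move: q0; rewrite qE mulf_eq0 negb_or => /andP[x0 y0].
  apply/orP; apply: contraT; rewrite negb_or.
  move=> /andP[/(bv_nonunit x0) vx /(bv_nonunit y0) vy].
  by move: vq; rewrite qE tofracM (bvM Hv) ?tofrac_eq0 //; lia.
split=> //; have [p p0 vp] := bv_prime Hv.
have q0F : q%:F != 0 by rewrite tofrac_eq0.
have vq := bv_nonunit q0 qNU; apply/eqP; rewrite eq_le andbC -gtz0_ge1 vq /=.
rewrite leNgt; apply/negP => vq1.
have [||y yE] := base_ringP _ (@bv_gt0 _ _ Hv (q%:F / p) _ _).
- by rewrite mulf_neq0 ?invr_eq0.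
- by rewrite bv_div // vp; lia.
have [||x xE] := base_ringP _ (@bv_gt0 _ _ Hv p _ _); rewrite ?vp //.
have qE : q = x * y.
  by apply/eqP; rewrite -tofrac_eq tofracM -xE -yE mulrC divfK.
have xNU : x \isn't a GRing.unit by apply: bv_gt0_nonunit; rewrite -xE vp.
have yNU : y \isn't a GRing.unit.
  by apply: bv_gt0_nonunit; rewrite -yE bv_div // vp; lia.
by case: (qirr x y qE); rewrite ?(negPf xNU) ?(negPf yNU).
Qed.

Lemma bv_prod s : irreducibles s -> v (\prod_(p <- s) p)%:F = (size s)%:Z.
Proof.
elim: s => [|p s IHs]; first by rewrite big_nil tofrac1 bv1.
move=> /irreducibles_cons[/irreducible_bv[p0 vp] sI].
rewrite big_cons tofracM (bvM Hv) ?tofrac_eq0 ?prod_irreducibles_neq0 //.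
by rewrite vp IHs //; lia.
Qed.

Lemma bv_fraction a s t : fraction_factorization s t a ->
  v a = (size s)%:Z - (size t)%:Z.
Proof.
move=> [sI tI [u uU ->]].
have s0 := prod_irreducibles_neq0 sI; have t0 := prod_irreducibles_neq0 tI.
have u0 : u != 0 by apply: contraTneq uU => ->; rewrite unitr0.
rewrite bv_div ?tofrac_eq0 ?mulf_neq0 // tofracM (bvM Hv) ?tofrac_eq0 //.
by rewrite bv_unit // !bv_prod // add0r.
Qed.

Lemma bv_atomic : atomic R.
Proof.
move=> x x0 xNU; have [p p0 vp] := bv_prime Hv.
have /base_ringP[q pE] : p \in base_ring R by apply: (bv_gt0 Hv); rewrite ?vp.
have q0 : q != 0 by rewrite -tofrac_eq0 -pE.
have qI : irreducible q by apply/irreducible_bv; rewrite -pE.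
have vx := bv_nonunit x0 xNU; have [n vxE] : exists n : nat, v x%:F = n.+1%:Z.
  by exists (absz (v x%:F)).-1; lia.
have x0F : x%:F != 0 by rewrite tofrac_eq0.
(* As [v x = n + 1], removing [n] factors [p] leaves an element of value 1, which is irreducible. *)
have vr : v (x%:F / p ^+ n) = 1.
  by rewrite bv_div ?expf_neq0 // exprnP bvX // vxE vp; lia.
have /base_ringP[r rE] : x%:F / p ^+ n \in base_ring R.
  by apply: (bv_gt0 Hv); rewrite ?vr // mulf_neq0 ?invr_eq0 ?expf_neq0.
exists (r :: nseq n q).
  apply/irreducibles_cons; split; last by move=> y /nseqP[->].
  apply/irreducible_bv; rewrite -rE -tofrac_eq0 -rE.
  by rewrite mulf_neq0 ?invr_eq0 ?expf_neq0.
apply/eqP; rewrite -tofrac_eq big_cons big_nseq iter_mulr_1.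
by rewrite tofracM tofracXn -rE -pE divfK // expf_neq0.
Qed.

Lemma bv_HFD : HFD R.
Proof.
split=> [|s t sI tI stE]; first exact: bv_atomic.
by apply/eqP; rewrite -eqz_nat -!bv_prod // stE.
Qed.

(** One of the two factors, say [a], has positive value. If [b] does too, both lie in R and ordinary
    primality applies. Otherwise [a / b] has positive value, and [a^2 = (a / b) (a b)] lies in the
    ideal, hence so does [a]. *)
Lemma bv_PVD : PVD R.
Proof.
move=> I; have I0 : 0 \in I := rpred0 I.
suff sq a b x : x \in I -> a * b = x%:F -> a != 0 -> b != 0 -> 0 < v a ->
    (exists2 y, y \in I & a = y%:F) \/ (exists2 y, y \in I & b = y%:F).
  move=> a b [x xI abE].
  have [->|a0] := eqVneq a 0; first by left; exists 0; rewrite ?tofrac0.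
  have [->|b0] := eqVneq b 0; first by right; exists 0; rewrite ?tofrac0.
  (* A nonzero element of the proper ideal [I] is a nonunit; its positive value forces [v a] or
     [v b] to be positive. *)
  have vab : 0 < v (a * b).
    rewrite abE; apply: bv_nonunit.
      by rewrite -tofrac_eq0 -abE mulf_neq0.
    apply/negP => xU; have := idealr1 I.
    by rewrite -[1](mulVr xU) prime_idealrM xI orbT.
  have [va|va] := ltP 0 (v a); first exact: (sq a b x).
  rewrite (bvM Hv) // in vab; rewrite mulrC in abE.
  by have [|bI|aI] := sq b a x xI abE b0 a0; [lia|right|left].
move=> xI abE a0 b0 va; have /base_ringP[y yE] := bv_gt0 Hv a0 va.
have [vb|vb] := ltP 0 (v b).
  have /base_ringP[z zE] := bv_gt0 Hv b0 vb.
  have : y * z \in I.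
    suff -> : y * z = x by [].
    by apply/eqP; rewrite -tofrac_eq tofracM -yE -zE abE.
  by rewrite prime_idealrM => /orP[yI|zI]; [left; exists y|right; exists z].
have /base_ringP[r rE] : a / b \in base_ring R.
  by apply: (bv_gt0 Hv); rewrite ?bv_div ?mulf_neq0 ?invr_eq0 //; lia.
left; exists y => //; suff : y * y \in I by rewrite prime_idealrM orbb.
suff -> : y * y = r * x by apply: idealMr.
apply/eqP; rewrite -tofrac_eq !tofracM -yE -rE -abE.
by rewrite mulrACA mulVf ?mulr1.
Qed.

(** * The valuation ring of [v] as an overring of R *)

Definition bv_ring : {pred {fraction R}} := fun a => (a == 0) || (0 <= v a).

Lemma bv_ringE a : a != 0 -> (a \in bv_ring) = (0 <= v a).
Proof. by rewrite unfold_in => /negPf->. Qed.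

Lemma bv_ring0 : 0 \in bv_ring.
Proof. by rewrite unfold_in eqxx. Qed.

Lemma base_ring_bv_ring : {subset base_ring R <= bv_ring}.
Proof.
move=> a aR; have [->|a0] := eqVneq a 0; first exact: bv_ring0.
by rewrite bv_ringE // (bv_ge0 Hv).
Qed.

(* If [v (1 + c) < 0] with [p] of value 1, then [p (1 + c)] is a unit of R, so
   that [c = (c p + c ^ 2 p) / (p (1 + c))] is in R. *)
Lemma bv_ring_add1 c : c \in bv_ring -> 1 + c \in bv_ring.
Proof.
have [->|c0] := eqVneq c 0.
  by rewrite addr0 => _; apply/base_ring_bv_ring/rpred1.
rewrite bv_ringE // => vc.
have [->|d0] := eqVneq (1 + c) 0; first exact: bv_ring0.
have [p p0 vp] := bv_prime Hv.
have pR : p \in base_ring R by rewrite (bv_gt0 Hv) ?vp.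
have cpR : c * p \in base_ring R.
  by apply: (bv_gt0 Hv); rewrite ?mulf_neq0 // (bvM Hv) // vp; lia.
have ccpR : c * (c * p) \in base_ring R.
  have cp0 : c * p != 0 by rewrite mulf_neq0.
  by apply: (bv_gt0 Hv); rewrite ?mulf_neq0 // !(bvM Hv) // vp; lia.
rewrite bv_ringE // leNgt; apply/negP => vd.
have dpE : (1 + c) * p = p + c * p by rewrite mulrDl mul1r.
have dpR : (1 + c) * p \in base_ring R by rewrite dpE rpredD.
have dp0 : (1 + c) * p != 0 by rewrite mulf_neq0.
have vdp : v ((1 + c) * p) = 0.
  by have := bv_ge0 Hv dp0 dpR; rewrite (bvM Hv) // vp; lia.
have dpVR := bv_eq0 Hv dp0 dpR vdp.
have cR : c \in base_ring R.
  suff -> : c = (c * p + c * (c * p)) * ((1 + c) * p)^-1.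
    by rewrite rpredM ?rpredD.
  by rewrite -mulrDr -dpE mulfK.
have : 1 + c \in base_ring R by rewrite rpredD ?rpred1.
by move=> /(bv_ge0 Hv d0); rewrite leNgt vd.
Qed.

Lemma bv_ringM a b : a \in bv_ring -> b \in bv_ring -> a * b \in bv_ring.
Proof.
have [->|a0] := eqVneq a 0; first by rewrite mul0r.
have [->|b0] := eqVneq b 0; first by rewrite mulr0.
by rewrite !bv_ringE ?mulf_neq0 // (bvM Hv) //; exact: addr_ge0.
Qed.

Lemma bv_ringN a : (- a \in bv_ring) = (a \in bv_ring).
Proof.
have [->|a0] := eqVneq a 0; first by rewrite oppr0.
by rewrite !bv_ringE ?oppr_eq0 // bvN.
Qed.

(** For [v a <= v b], writing [a + b = a (1 + b / a)] reduces the sum to [bv_ring_add1]. *)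
Lemma bv_ringD a b : a \in bv_ring -> b \in bv_ring -> a + b \in bv_ring.
Proof.
have [->|a0] := eqVneq a 0; first by rewrite add0r.
have [->|b0] := eqVneq b 0; first by rewrite addr0.
wlog vab : a b a0 b0 / v a <= v b.
  move=> IH aV bV; have [/IH|/ltW/IH] := leP (v a) (v b); first exact.
  by rewrite addrC; apply.
move=> aV bV; have -> : a + b = a * (1 + b / a).
  by rewrite mulrDr mulr1 mulrCA divff // mulr1.
apply/bv_ringM/bv_ring_add1 => //.
by rewrite bv_ringE ?mulf_neq0 ?invr_eq0 // bv_div // subr_ge0.
Qed.

Lemma bv_ring_closed : subring_closed bv_ring.
Proof.
split=> [|a b aV bV|]; last exact: bv_ringM.
  by apply/base_ring_bv_ring/rpred1.
by apply: bv_ringD; rewrite ?bv_ringN.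
Qed.

Definition bv_subring : subringClosed {fraction R} :=
  HB.pack (bv_ring : {fraction R} -> bool)
    (GRing.isSubringClosed.Build {fraction R} bv_ring bv_ring_closed).

Lemma bv_valuation_overring : valuation_overring bv_subring.
Proof.
have [p p0 vp] := bv_prime Hv; split; first split.
- exact: base_ring_bv_ring.
- by exists p^-1; rewrite [_ \in _]bv_ringE ?invr_eq0 // bvV // vp.
move=> a a0; rewrite [_ \in _]bv_ringE // [a^-1 \in _]bv_ringE ?invr_eq0 //.
by rewrite bvV //; lia.
Qed.

Lemma bv_boundary_positive : boundary_positive bv_subring.
Proof.
move=> a s t aV a0 /bv_fraction vaE.
by move: aV; rewrite [_ \in _]bv_ringE // vaE; lia.
Qed.

(** Unequal lengths turn [0 <= v a] into [0 < v a]. *)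
Lemma bv_boundary_complete : boundary_complete bv_subring.
Proof.
move=> a s t aV a0 /bv_fraction vaE st; apply: (bv_gt0 Hv a0).
by move: aV; rewrite [_ \in _]bv_ringE // vaE; lia.
Qed.

(** * Groups of divisibility, split by the powers of an element of value 1 *)

Lemma bv_uniformizer : exists pz : int -> mult_group {fraction R},
  zmod_morphism pz /\ forall n, v (val (pz n)) = n.
Proof.
have [p p0 vp] := bv_prime Hv.
exists (fun n => exist _ (p ^ n) (expfz_neq0 n p0)); split=> [m n|n].
  by apply: val_inj; rewrite /= expfzDr // invr_expz.
by rewrite /= bvX // vp mul1r.
Qed.

Lemma bv_val_zmod_morphism :
  zmod_morphism (fun x : mult_group {fraction R} => v (val x)).
Proof. by move=> x y; rewrite /= bv_div ?(valP x) ?(valP y). Qed.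

Lemma bv_div_group_int : po_isomorphic (div_group bv_subring) int.
Proof.
have [pz [_ vpz]] := bv_uniformizer.
apply: (div_group_po_isomorphic bv_val_zmod_morphism vpz) => x y.
have [x0 y0] := (valP x, valP y).
rewrite [_ \in _]bv_ringE ?mulf_neq0 ?invr_eq0 //.
by rewrite mulrC bv_div // subr_ge0.
Qed.

(** The isomorphism sends [z] to [v z] together with the class of [z / p^(v z)], where [v p = 1].
    Unequal values decide divisibility in R; at equal values divisibility means that the quotient is
    a unit of R, which is the trivial order. *)
Lemma bv_div_group_lex_sum :
  po_isomorphic (div_group (base_ring R))
    (lex_sum int
       (trivially_ordered (units_quotient bv_subring (base_ring R)))).
Proof.
have [pz [pzB vpz]] := bv_uniformizer.
have vB := bv_val_zmod_morphism.
pose V := bv_subring; pose Q := units_quotient V (base_ring R).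
have unitV z : (z \in units_of V) = (v (val z) == 0).
  have z0 := valP z; rewrite unfold_in [_ \in _]bv_ringE //.
  by rewrite [_^-1 \in _]bv_ringE ?invr_eq0 // bvV //; lia.
(* The element [z - pz (v z)], written additively, has value 0; so it is a unit of [V] and [insubd]
   returns it. *)
pose u (z : mult_group {fraction R}) : unit_group V :=
  insubd (0 : unit_group V) (z - pz (v (val z))).
have uE z : val (u z) = z - pz (v (val z)).
  by rewrite insubdK // unitV vB vpz subrr.
pose f (z : mult_group {fraction R}) : lex_sum int (trivially_ordered Q) :=
  (v (val z), \pi_Q (u z)).
pose g (c : lex_sum int (trivially_ordered Q)) : mult_group {fraction R} :=
  pz c.1 + val (repr (c.2 : Q)).
apply: (@div_group_po_isomorphic _ _ _ f g).
- move=> z1 z2; rewrite /f vB; congr (_, _).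
  have -> : u (z1 - z2) = u z1 - u z2.
    apply: val_inj; rewrite [RHS]/= !uE vB pzB.
    by rewrite !opprD !opprK addrACA.
  by rewrite !piE.
- move=> [n c]; rewrite /f /g /=; set w := repr _.
  have vw : v (val (pz n + val w)) = n.
    have /eqP wV : v (val (val w)) == 0 by rewrite -unitV; exact: valP w.
    by rewrite /= (bvM Hv) ?(valP (pz n)) ?(valP (val w)) // vpz wV addr0.
  congr (_, _); first exact: vw.
  rewrite -[RHS]reprK; congr (\pi_Q _); apply: val_inj.
  by rewrite uE vw addrAC subrr add0r.
move=> z1 z2; rewrite lex_sum_leE /=.
have [z10 z20] := (valP z1, valP z2).
have z210 : (val z1)^-1 * val z2 != 0 by rewrite mulf_neq0 ?invr_eq0.
have vz21 : v ((val z1)^-1 * val z2) = v (val z2) - v (val z1).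
  by rewrite mulrC bv_div.
case: ltgtP => /= [v12|v21|v12].
- by symmetry; apply: (bv_gt0 Hv); rewrite // vz21 subr_gt0.
- symmetry; apply/negP => /(bv_ge0 Hv z210).
  by rewrite vz21 subr_ge0 leNgt v21.
transitivity (\pi_Q (u z1) == \pi_Q (u z2)); first by [].
rewrite piE; transitivity (val (u z1) - val (u z2) \in units_of (base_ring R)).
  by [].
rewrite !uE v12 opprD addrACA subrr addr0.
transitivity ((val z1 / val z2 \in base_ring R) &&
              ((val z1 / val z2)^-1 \in base_ring R)); first by [].
rewrite invf_div [X in _ && (X \in _)]mulrC.
(* The quotient [z2 / z1] has value 0, so once it lies in R its inverse does as well. *)
apply: andb_idl => zR; have := bv_eq0 Hv z210 zR; rewrite vz21 v12 subrr.
by move=> /(_ erefl); rewrite invfM invrK.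
Qed.

End BoundaryValuationTheory.

(** When the numerator is longer, positivity keeps [a^-1] out of [V]. So the valuation property puts
    [a] in [V], and completeness puts it in R. *)
Lemma boundary_complete_BVD (R : idomainType) (V : subringClosed {fraction R}) :
  HFD R -> valuation_overring V -> boundary_positive V ->
  boundary_complete V -> BVD R.
Proof.
move=> Rhfd [_ Vval] Vpos Vcomp; split=> // a s t stP ts.
have [->|a0] := eqVneq a 0; first by rewrite rpred0.
apply: (Vcomp a s t) => //; last by lia.
have [//|aV] := Vval a a0; have [sI tI [u uU aE]] := stP.
have tsP : fraction_factorization t s a^-1.
  split=> //; exists u^-1; rewrite ?unitrV // aE invf_div !tofracM rmorphV //.
  by rewrite invfM mulrA [X in X / _ = _]mulrC.
by have := Vpos _ t s aV; rewrite invr_eq0 leqNgt ts => /(_ a0 tsP).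
Qed.

Theorem theorem6p3 (R : idomainType) (R_not_field : not_a_field R) :
  [<-> BVD R;
       HFD R /\
         (exists V : subringClosed {fraction R},
            [/\ valuation_overring V, boundary_positive V, boundary_complete V &
                po_isomorphic (div_group V) int]);
       (exists V : subringClosed {fraction R},
          overring V /\
          po_isomorphic (div_group (base_ring R))
            (lex_sum int (trivially_ordered (units_quotient V (base_ring R)))));
       atomic R /\ PVD R].
Proof.
tfae=> [Rbvd|[Rhfd [V [Vval Vpos Vcomp _]]]|[V [_ GR_iso]]|[Rat Rpvd]].
- have [v vP] := BVD_boundary_valuation R_not_field Rbvd.
  split; first exact: bv_HFD vP.
  exists (bv_subring vP); split.
  + exact: bv_valuation_overring.
  + exact: bv_boundary_positive.
  + exact: bv_boundary_complete.
  + exact: bv_div_group_int.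
(* The given [V] serves to recover the BVD property; the overring of the next condition is rebuilt
   from the counting valuation. *)
- have Rbvd := boundary_complete_BVD Rhfd Vval Vpos Vcomp.
  have [v vP] := BVD_boundary_valuation R_not_field Rbvd.
  exists (bv_subring vP); split; last exact: bv_div_group_lex_sum.
  by have [] := bv_valuation_overring vP.
- have [v vP] := lex_sum_boundary_valuation GR_iso.
  by split; [exact: bv_atomic vP | exact: bv_PVD vP].
exact: atomic_sprime_BVD (PVD_nonunits Rpvd) Rat.
Qed.
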